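(* Let $n, l_1, \dots, l_n$ be positive integers and let $U$ be a convex open set of $\mathbb{C}^{l_1}\times\mathbb{C}^{l_2}\times\cdots\times\mathbb{C}^{l_n}$. For $j=1,\dots,n$ let $\pi_j(U)\subset\mathbb{C}^{l_j}$ be the image of $U$ under the projection to the $j$-th factor. (1) For every $f\in O_{l_1,\dots,l_n}(U)$ there exists $g\in O_{l_1,\dots,l_n}(\pi_1(U)\times\pi_2(U)\times\cdots\times\pi_n(U))$ such that $f=g|_U$. (2) If $U$ is $\mathbb{C}^n$-holomorphically convex, then $U=\pi_1(U)\times\pi_2(U)\times\cdots\times\pi_n(U)$.
   Context: Write $X=\mathbb{C}^{l_1}\times\cdots\times\mathbb{C}^{l_n}$ with points $z=(z_1,\dots,z_n)$, $z_j\in\mathbb{C}^{l_j}$. For $w_1,\dots,w_m\in\mathbb{C}$, $|(w_1,\dots,w_m)|$ denotes $\max_k|w_k|$. $\mathbb{C}^n$-holomorphic functions: for an open set $U\subset X$, a map $f=(f_1,\dots,f_n):U\to\mathbb{C}^n$ (each $f_i$ complex-valued) is $\mathbb{C}^n$-holomorphic if $f$ is holomorphic and for every $a\in U$ and all $i\neq j$ in $\{1,\dots,n\}$, $\frac{\partial f_i}{\partial z_j}(a)=0$ (i.e. all partial derivatives of $f_i$ with respect to the coordinates of $z_j\in\mathbb{C}^{l_j}$ vanish at $a$). $O_{l_1,\dots,l_n}(U)$ denotes the set of all $\mathbb{C}^n$-valued $\mathbb{C}^n$-holomorphic functions on $U$. $\mathbb{C}^n$-holomorphically convex: for $K\subset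 U$ compact, put $\widehat{K}^U_{l_1,\dots,l_n}=\{z\in U : \forall f\in O_{l_1,\dots,l_n}(U),\ |f(z)|\le\sup_{w\in K}|f(w)|\}$. $U$ is $\mathbb{C}^n$-holomorphically convex if $\widehat{K}^U_{l_1,\dots,l_n}$ is compact for every compact $K\subset U$. *)

(* Defs.v *)
From HB Require Import structures.
From mathcomp Require Import all_boot all_order all_algebra.
From mathcomp Require Import all_classical all_reals all_analysis.
From mathcomp.real_closed Require Import complex.

Set Implicit Arguments.
Unset Strict Implicit.
Unset Printing Implicit Defensive.

Import Order.TTheory GRing.Theory Num.Theory.
Import numFieldNormedType.Exports.

Local Open Scope classical_set_scope.
Local Open Scope ring_scope.

(* The generic numFieldType instances are not found on the concrete type R[i];
   this gives it the topology of its norm, as a normed module over itself. *)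
#[non_forgetful_inheritance]
HB.instance Definition _ (R : realType) := NormedModule.copy R[i] R[i]^o.

(* A point z = (z_1, ..., z_n) of C^{l_1} x ... x C^{l_n} is a block row vector
   z : 'rV[R[i]]_(\sum_j l j), with z_j = submxrow z j : 'rV[R[i]]_(l j); the
   k-th coordinate of z_j has index tagnat.Rank j k.  The library topology on
   row vectors is that of the max norm, i.e. the product topology.
   A function on an open set U is a total function whose values outside U are
   irrelevant. *)
Section CnHolomorphic.
Context {R : realType} {n : nat} {l : 'I_n -> nat}.

Local Notation C := R[i].
Local Notation X := ('rV[C]_(\sum_(j < n) l j)).

Implicit Types (U K : set X) (f : X -> 'rV[C]_n).

(* Differentiability is over the scalar field R[i], hence C-linear. *)
Definition holomorphic_on U f : Prop := forall a, U a -> differentiable f a.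

Definition Cn_holomorphic_on U f : Prop :=
  holomorphic_on U f /\
  forall a, U a -> forall i j : 'I_n, i != j -> forall k : 'I_(l j),
    'D_(delta_mx 0 (tagnat.Rank j k)) (fun z => f z 0 i) a = 0.

Definition maxnormc (w : 'rV[C]_n) : R :=
  \big[Num.max/0]_(k < n) Normc.normc (w 0 k).

(* The sup of moduli is taken in R; for K = set0 it is 0 by convention, and
   the hull of set0 is then empty (if 0 < n) since constants are C^n-holomorphic. *)
Definition Cn_hull U K : set X :=
  [set z | U z /\ forall f, Cn_holomorphic_on U f ->
     maxnormc (f z) <= sup [set maxnormc (f w) | w in K]].

Definition Cn_holomorphically_convex U : Prop :=
  forall K, K `<=` U -> compact K -> compact (Cn_hull U K).

Definition block_proj (j : 'I_n) U : set 'rV[C]_(l j) :=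
  [set submxrow z j | z in U].

Definition prod_block_proj U : set X :=
  [set z | forall j, @block_proj j U (submxrow z j)].

End CnHolomorphic.

Arguments block_proj {R n l} j U _.

(* Main.v *)
(* On a convex U the component f_i of a C^n-holomorphic f depends only on the
   block z_i: two points of U with the same i-th block are joined by a segment
   in U along which f_i has zero derivative.  Hence f_i descends to pi_i(U),
   which gives the extension g.  It also shows that the hull of K contains
   every z in U with z_i in pi_i(K) for all i.  Given p in the product of the
   projections, choose u^i in U with u^i_i = p_i, fix u0 in U, and let K be the
   union of the segments [u0, u^i].  The part of [u0, p] inside U is then
   contained in the hull of K, so when the hull is compact this part is closed
   as well as open in [u0, p], and p belongs to U. *)

Require Import Defs.
From mathcomp Require Import all_boot all_order all_algebra.
From mathcomp Require Import all_classical all_reals all_analysis.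
From mathcomp.real_closed Require Import complex.

Import Order.TTheory GRing.Theory Num.Theory.
Import numFieldNormedType.Exports.

Local Open Scope classical_set_scope.
Local Open Scope ring_scope.

(** * From complex derivatives to real functions on an interval *)

Lemma Re_continuous (R : realType) : continuous (@complex.Re R).
Proof.
move=> x; apply/(@cvgrPdist_lt _ _ _ (nbhs x)) => e e0.
have e0C : (0 : R[i]) < e%:C%C by rewrite ltcR.
near=> y.
have : `|x - y| < e%:C%C.
  near: y; exact: (@cvgr_dist_lt _ _ _ (nbhs x) _ id x).
rewrite -ltcR; apply: le_lt_trans.
have := normc_ge_Re (x - y).
by rewrite raddfB.
Unshelve. all: by end_near. Qed.

Lemma real_complex_continuous (R : realType) : continuous (real_complex R).
Proof.
move=> x; apply/(@cvgrPdist_lt _ _ _ (nbhs x)) => e e0.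
have [k ke] : exists k, e = k%:C%C by apply/complex_realP/gtr0_real.
have k0 : 0 < k by rewrite -ltcR -ke.
near=> y.
have : `|x - y| < k.
  near: y; exact: (@cvgr_dist_lt _ _ _ (nbhs x) _ id x).
rewrite -ltcR -ke; apply: le_lt_trans.
by rewrite -raddfB normc_def /= expr0n addr0 sqrtr_sqr.
Unshelve. all: by end_near. Qed.

Lemma normc_continuous (R : realType) : continuous (@Normc.normc R).
Proof.
have -> : @Normc.normc R = @complex.Re R \o (fun x => `|x|).
  by apply/funext => z; rewrite /comp normc_def; case: z.
move=> x; apply: continuous_comp; last exact: Re_continuous.
exact: (@norm_continuous R[i] R[i]).
Qed.

(** The real difference quotient is the real part of the complex one along real increments, because
    taking real parts commutes with multiplication by a real [h^-1]. Continuity of the real part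
    carries the limit over. *)
Lemma is_derive_Re (R : realType) (phi : R[i] -> R[i]) (t : R) :
  is_derive (t%:C%C : R[i]) (1 : R[i]) phi 0 ->
  is_derive t (1 : R) (fun s : R => complex.Re (phi s%:C%C)) 0.
Proof.
case=> dphi phi0.
have H : (fun h : R => h^-1 *: (complex.Re (phi (h *: 1 + t)%:C%C) -
    complex.Re (phi t%:C%C)) : R) @ (0 : R)^' --> (0 : R).
  (* Injectivity of the embedding keeps nonzero increments nonzero. *)
  have emb : real_complex R @ (0 : R)^' --> (0 : R[i])^'.
    move=> A; rewrite /nbhs /= /within /= => A0.
    move: (real_complex_continuous R (0 : R) _ A0).
    apply: (@filterS _ (nbhs (0 : R)) _ _ _) => x /= Ax x0; apply: Ax.
    by apply: contra x0 => /eqP/complexI ->.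
  have lim : (fun h : R[i] => h^-1 *: (phi (h *: 1 + t%:C%C) - phi t%:C%C))
      @ (0 : R[i])^' --> (0 : R[i]).
    by rewrite -[X in _ --> X]phi0; exact: dphi.
  have := cvg_comp _ _ (cvg_comp _ _ emb lim) (Re_continuous R 0).
  apply: cvg_trans; apply: near_eq_cvg; near=> h => /=.
  have -> : (h *: 1 + t)%:C%C = h%:C%C *: 1 + t%:C%C :> R[i].
    by rewrite rmorphD /= /GRing.scale /= rmorphM.
  rewrite -fmorphV /= /GRing.scale /=; case: (phi _) => a b; case: (phi _) => c d /=.
  by rewrite mul0r subr0.
by split; [apply/cvg_ex; exists 0; exact: H | exact: cvg_lim].
Unshelve. all: by end_near. Qed.

(** The mean value theorem needs real values, so it is applied to the real part of [phi], and then
    to that of ['i%C *: phi], which is minus the imaginary part. *)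
Lemma segment_is_derive0_cst (R : realType) (phi : R[i] -> R[i]) :
  (forall t : R, 0 <= t <= 1 -> is_derive (t%:C%C : R[i]) (1 : R[i]) phi 0) ->
  phi 0 = phi 1.
Proof.
have reP (psi : R[i] -> R[i]) : (forall t : R, 0 <= t <= 1 ->
    is_derive (t%:C%C : R[i]) (1 : R[i]) psi 0) ->
    complex.Re (psi 0) = complex.Re (psi 1).
  move=> dpsi.
  have dRe (t : R) : t \in `[0, 1] ->
      is_derive t (1 : R) (fun s : R => complex.Re (psi s%:C%C)) 0.
    by rewrite in_itv /= => t01; apply: is_derive_Re; exact: dpsi.
  set h := (fun s : R => complex.Re (psi s%:C%C)) in dRe *.
  have -> : complex.Re (psi 0) = h 0 by [].
  have -> : complex.Re (psi 1) = h 1 by [].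
  have dh (t : R) : t \in `]0, 1[ -> is_derive t (1 : R) h 0.
    by move=> t01; apply: dRe; exact: subset_itv_oo_cc.
  have ch : {within `[0, 1], continuous h}.
    by apply: derivable_within_continuous => t t01; have [] := dRe t t01.
  clearbody h.
  have [c _] := @MVT_segment R h (fun=> 0) 0 1 ler01 dh ch.
  by rewrite mul0r => /eqP; rewrite subr_eq0 => /eqP ->.
move=> dphi; have Re_eq := reP _ dphi.
have Im_eq : complex.Im (phi 0) = complex.Im (phi 1).
  apply: oppr_inj; rewrite -!ReiNIm.
  have := reP (fun z => 'i%C *: phi z).
  rewrite /GRing.scale /= ![_ * 'i%C]mulrC; apply => t t01.
  by have := is_deriveZ 'i%C (dphi t t01); rewrite scaler0.
by move: Re_eq Im_eq; case: (phi 0) (phi 1) => a b [c d] /= -> ->.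
Qed.

(** * Segments, and dependence of a component on its own block *)

Definition segment_path {R : realType} {V : lmodType R[i]} (u v : V) (t : R)
    : V := t%:C%C *: (v - u) + u.

Lemma segment_path_continuous (R : realType) (V : normedModType R[i])
    (u v : V) :
  continuous (segment_path u v).
Proof.
move=> t; apply: (@continuousD R[i] V R (fun t => t%:C%C *: (v - u)) (fun=> u));
  last exact: cst_continuous.
apply: (@continuous_comp _ _ _ (real_complex R) (fun c => c *: (v - u))).
  exact: real_complex_continuous.
exact: scalel_continuous.
Qed.

Lemma convex_set_segment (R : realType) (V : lmodType R[i]) (U : set V)
    (u v : V) (t : R) :
  convex_set U -> U u -> U v -> 0 <= t <= 1 -> U (segment_path u v t).
Proof.
move=> cU Uu Uv /andP[t0 t1].
have t0C : 0 <= t%:C%C :> R[i] by rewrite lecR.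
have t1C : t%:C%C <= 1 :> R[i] by rewrite lecR.
have := cU v u (Itv01 t0C t1C) (mem_set Uv) (mem_set Uu).
rewrite inE /segment_path /conv /= /unstable.onem scalerBl scale1r.
by rewrite scalerBr addrA [X in U X]addrAC.
Qed.

(** The first-order expansion of [f] at [a] is also one of [g], and uniqueness identifies the
    differentials. It serves to replace the extension by a formula valid only near a point. *)
Lemma near_eq_differentiable (K : numFieldType) (V W : normedModType K)
    (f g : V -> W) (a : V) :
  (\near a, f a = g a) -> differentiable f a -> differentiable g a.
Proof.
move=> fg df.
have fga : f a = g a by exact: nbhs_singleton fg.
have fgs : \forall h \near (0 : V), f (h + a) = g (h + a).
  by move: fg; rewrite (near_shift (0 : V)) subr0.
have dgo : g \o shift a = cst (g a) + 'd f a +o_ (0 : V) id.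
  apply/eqaddoP => e e0.
  have /eqaddoP/(_ e e0) fo := diff_locally df.
  near=> h.
  have -> : (g \o shift a - (cst (g a) + 'd f a)) h =
            (f \o shift a - (cst (f a) + 'd f a)) h.
    rewrite !fctE /= -fga; congr (_ - _); apply/esym.
    by near: h.
  by near: h.
have dgf : 'd g a = 'd f a :> (V -> W).
  by apply: diff_unique dgo; exact: diff_continuous.
by apply/diff_locallyP; rewrite dgf; split => //; exact: diff_continuous.
Unshelve. all: by end_near. Qed.

Lemma Cn_holomorphic_block_eq (R : realType) (n : nat) (l : 'I_n -> nat)
    (U : set 'rV[R[i]]_(\sum_(j < n) l j))
    (f : 'rV[R[i]]_(\sum_(j < n) l j) -> 'rV[R[i]]_n) (i : 'I_n) u v :
  convex_set U -> Cn_holomorphic_on U f -> U u -> U v ->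
  submxrow u i = submxrow v i -> f u 0 i = f v 0 i.
Proof.
move=> cU [df f0] Uu Uv uv.
pose w := v - u; pose g := fun z => f z 0 i.
have w0 (k : 'I_(l i)) : w 0 (tagnat.Rank i k) = 0.
  move/matrixP : uv => /(_ 0 k); rewrite !mxE => uv.
  by rewrite uv subrr.
have dg a : U a -> differentiable g a.
  move=> /df dfa; apply: (@differentiable_comp _ _ _ _ f (fun y => y 0 i)).
    exact: dfa.
  exact: differentiable_coord.
have gw a : U a -> is_derive a w g 0.
  move=> Ua; split; first exact/diff_derivable/dg.
  rewrite deriveE; last exact: dg.
  (* The derivative along [w] is a combination of partial derivatives: those outside block [i]
     vanish by hypothesis, those inside have coefficient 0 in [w]. *)
  rewrite (row_sum_delta w) linear_sum big1 // => k _.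
  rewrite linearZ /= -deriveE; last exact: dg.
  rewrite -(tagnat.sig2K k).
  have [ki|ki] := eqVneq (tagnat.sig1 k) i; last first.
    by rewrite f0 ?scaler0 // eq_sym.
  move: (tagnat.sig2 k); rewrite ki => k'.
  by rewrite w0 scale0r.
pose phi (c : R[i]) := g (c *: w + u).
have : phi 0 = phi 1.
  apply: segment_is_derive0_cst => t /andP[t0 t1].
  have Ut : U (t%:C%C *: w + u).
    by apply: convex_set_segment => //; rewrite t0 t1.
  have shiftE : (fun h : R[i] => h^-1 *: (phi (h *: 1 + t%:C%C) - phi t%:C%C))
      = (fun h => h^-1 *:
          (g (h *: w + (t%:C%C *: w + u)) - g (t%:C%C *: w + u))).
    by apply/funext => h; rewrite /phi [h *: 1]mulr1 scalerDl addrA.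
  have [dw Dw] := gw _ Ut.
  by split; [rewrite /derivable shiftE | rewrite /derive shiftE].
by rewrite /phi /g scale0r add0r scale1r subrK.
Qed.

Lemma differentiable_row (R : numFieldType) (V : normedModType R) (n : nat)
    (f : V -> 'rV[R]_n) (a : V) :
  (forall i, differentiable (fun z => f z 0 i : R^o) a) -> differentiable f a.
Proof.
move=> df.
have -> : f = \sum_(i < n) (fun z => f z 0 i *: delta_mx 0 i).
  by apply/funext => z; rewrite fct_sumE -row_sum_delta.
by apply: differentiable_sum => i; exact: differentiableZl.
Qed.

(** * Extension to the product of the projections *)

Section Extension.
Context {R : realType} {n : nat} {l : 'I_n -> nat}.
Local Notation X := 'rV[R[i]]_(\sum_(j < n) l j).
Variables (U : set X) (f : X -> 'rV[R[i]]_n).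

(** The choice need not be continuous in [z]; the default [z] is returned only when the [i]-th block
    of [z] is not in the projection of [U]. *)
Definition block_pick (i : 'I_n) (z : X) : X :=
  xget z [set u | U u /\ submxrow u i = submxrow z i].

Definition block_extension (z : X) : 'rV[R[i]]_n :=
  \row_i f (block_pick i z) 0 i.

(** This is [u] with its [i]-th block replaced by that of [z], written as a sum of affine terms so
    that differentiability in [z] is immediate. *)
Definition set_block (i : 'I_n) (u z : X) : X :=
  u + \sum_(k < l i) (z 0 (tagnat.Rank i k) - u 0 (tagnat.Rank i k)) *:
    delta_mx 0 (tagnat.Rank i k).

Lemma submxrow_set_block i u z : submxrow (set_block i u z) i = submxrow z i.
Proof.
apply/rowP => k; rewrite !mxE summxE (bigD1 k) //= !mxE !eqxx /= mulr1.
rewrite [X in _ + (_ + X)]big1 => [|k' k'k]; first by rewrite addr0 subrKC.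
rewrite !mxE /= -val_eqE tagnat.eq_Rank eqxx /= eq_sym val_eqE.
by rewrite (negPf k'k) mulr0.
Qed.

Lemma set_block_id i u z : submxrow u i = submxrow z i -> set_block i u z = u.
Proof.
move=> /rowP uz; rewrite /set_block [X in _ + X]big1 ?addr0 // => k _.
by move: (uz k); rewrite !mxE => ->; rewrite subrr scale0r.
Qed.

Lemma differentiable_set_block i u a : differentiable (set_block i u) a.
Proof.
apply: differentiableD; first exact: differentiable_cst.
have -> : (fun z : X => \sum_(k < l i) (z 0 (tagnat.Rank i k) -
    u 0 (tagnat.Rank i k)) *: (delta_mx 0 (tagnat.Rank i k) : X)) =
  \sum_(k < l i) (fun z : X => (z 0 (tagnat.Rank i k) -
    u 0 (tagnat.Rank i k)) *: (delta_mx 0 (tagnat.Rank i k) : X)).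
  by apply/funext => z; rewrite fct_sumE.
apply: differentiable_sum => k; apply: differentiableZl.
apply: differentiableB; first exact: differentiable_coord.
exact: differentiable_cst.
Qed.

Hypotheses (Uo : open U) (Uc : convex_set U) (fU : Cn_holomorphic_on U f).

Lemma block_extensionE i u z : U u -> submxrow u i = submxrow z i ->
  block_extension z 0 i = f u 0 i.
Proof.
move=> Uu uz; rewrite mxE.
have [Up pz] : [set u | U u /\ submxrow u i = submxrow z i] (block_pick i z).
  by apply: xgetPex; exists u.
by apply: Cn_holomorphic_block_eq Uc fU Up Uu _; rewrite pz uz.
Qed.

Lemma Cn_holomorphic_block_extension :
  Cn_holomorphic_on (prod_block_proj U) block_extension.
Proof.
split=> [a Pa | a Pa i j ij k].
  apply: differentiable_row => i.
  have [u Uu ua] := Pa i.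
  apply: (@near_eq_differentiable _ _ _ (fun z => f (set_block i u z) 0 i)).
    (* At [z = a] the value is [u], so openness of [U] makes [set_block i u z] a differentiable
       choice of representative near [a]. *)
    have Usb : \forall z \near a, U (set_block i u z).
      have /differentiable_continuous sbc := differentiable_set_block i u a.
      apply: sbc; rewrite set_block_id //.
      exact: open_nbhs_nbhs.
    near=> z; apply/esym; apply: block_extensionE; first by near: z.
    exact: submxrow_set_block.
  apply: (@differentiable_comp _ _ _ _ (set_block i u) (fun y => f y 0 i)).
    exact: differentiable_set_block.
  rewrite set_block_id //.
  apply: (@differentiable_comp _ _ _ _ f (fun y => y 0 i)).
    exact: fU.1.
  exact: differentiable_coord.
have [u Uu ua] := Pa i.
(* Moving in block [j] leaves block [i] fixed, so the same [u] represents both points. *)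
have cstE (h : R[i]) :
    block_extension (h *: delta_mx 0 (tagnat.Rank j k) + a) 0 i =
    block_extension a 0 i.
  rewrite !(block_extensionE i u) //.
  rewrite ua; apply/rowP => k'; rewrite !mxE /= -val_eqE tagnat.eq_Rank.
  by rewrite (negPf ij) mulr0 add0r.
rewrite /derive.
have -> : (fun h : R[i] => h^-1 *: (block_extension
    (h *: delta_mx 0 (tagnat.Rank j k) + a) 0 i - block_extension a 0 i)) =
    fun=> 0.
  by apply/funext => h; rewrite cstE subrr scaler0.
exact: lim_cst.
Unshelve. all: by end_near. Qed.

End Extension.

(** * Bounds on compact sets and points of the hull *)

Lemma le_maxnormc (R : realType) (n : nat) (w : 'rV[R[i]]_n) (k : 'I_n) :
  Normc.normc (w 0 k) <= maxnormc w.
Proof. by rewrite /maxnormc; exact: le_bigmax. Qed.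

(** The real [sup] is certain to dominate the elements of a set only when that set is bounded
    above. *)
Lemma has_ubound_maxnormc (R : realType) (n m : nat) (K : set 'rV[R[i]]_m)
    (f : 'rV[R[i]]_m -> 'rV[R[i]]_n) :
  compact K -> {in K, continuous f} ->
  has_ubound [set maxnormc (f w) | w in K].
Proof.
move=> cK cf.
have bk (k : 'I_n) : exists M : R, forall w, K w -> Normc.normc (f w 0 k) <= M.
  have : compact ((fun w => Normc.normc (f w 0 k)) @` K).
    apply: continuous_compact => //; apply: continuous_in_subspaceT => w Kw.
    apply: (@continuous_comp _ _ _ (fun w => f w 0 k) (@Normc.normc R));
      last exact: normc_continuous.
    apply: (@continuous_comp _ _ _ f (fun y => y 0 k)); first exact: cf.
    exact: coord_continuous.
  move=> /compact_bounded [M [_ /(_ (M + 1))]].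
  rewrite ltrDl ltr01 => /(_ isT) bM; exists (M + 1) => w Kw.
  by apply: le_trans (ler_norm _) (bM _ _); exists w.
have [M MP] := choice bk.
exists (\big[Num.max/0]_k M k) => _ [w Kw <-].
apply: le_bigmax2 => k _; exact: MP.
Qed.

(** The max norm involves one component at a time, so each component may be compared at a different
    point of [K]. *)
Lemma Cn_hull_block (R : realType) (n : nat) (l : 'I_n -> nat)
    (U K : set 'rV[R[i]]_(\sum_(j < n) l j))
    (z : 'rV[R[i]]_(\sum_(j < n) l j)) :
  convex_set U -> K `<=` U -> compact K -> U z -> (0 < n)%N ->
  (forall j, block_proj j K (submxrow z j)) -> Cn_hull U K z.
Proof.
move=> Uc KU cK Uz n0 zK; split=> // f fU.
have ubK : has_ubound [set maxnormc (f w) | w in K].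
  apply: has_ubound_maxnormc => // w; rewrite inE => /KU Uw.
  exact/differentiable_continuous/fU.1.
have le_sup w : K w -> maxnormc (f w) <= sup [set maxnormc (f w) | w in K].
  by move=> Kw; apply: ub_le_sup => //; exists w.
apply: bigmax_le => [|k _].
  (* The maximum starts from 0, so the supremum must be shown nonnegative; a point of [K] gives
     this. *)
  have [w Kw _] := zK (Ordinal n0).
  exact: le_trans (bigmax_ge_id _ _ _ _) (le_sup w Kw).
have [w Kw wz] := zK k.
rewrite (Cn_holomorphic_block_eq _ _ _ _ _ _ z w Uc fU Uz (KU _ Kw)) //.
exact: le_trans (le_maxnormc _ _ _ _) (le_sup w Kw).
Qed.

(* convex_set over the scalar field R[i] is the usual real convexity: its
   weights t satisfy 0 <= t <= 1 in R[i], which forces t to be real. *)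
Theorem corollary10 (R : realType) (n : nat) (n_gt0 : (0 < n)%N)
    (l : 'I_n -> nat) (l_gt0 : forall j, (0 < l j)%N)
    (U : set 'rV[R[i]]_(\sum_(j < n) l j))
    (U_open : open U) (U_convex : convex_set U) :
  (forall f : 'rV[R[i]]_(\sum_(j < n) l j) -> 'rV[R[i]]_n,
     Cn_holomorphic_on U f ->
     exists2 g : 'rV[R[i]]_(\sum_(j < n) l j) -> 'rV[R[i]]_n,
       Cn_holomorphic_on (prod_block_proj U) g &
       forall z, U z -> f z = g z) /\
  (Cn_holomorphically_convex U -> U = prod_block_proj U).
Proof.
split=> [f fU | Uhc].
  exists (block_extension U f); first exact: Cn_holomorphic_block_extension.
  by move=> z Uz; apply/rowP => i; rewrite (block_extensionE _ _ _ _ _ z).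
apply/seteqP; split => [z Uz j | p Pp]; first by exists z.
have /choice [u uP] : forall j : 'I_n,
    exists u, U u /\ submxrow u j = submxrow p j.
  by move=> j; have [u Uu up] := Pp j; exists u.
pose u0 := u (Ordinal n_gt0).
have Uu0 : U u0 := (uP _).1.
pose K := \big[setU/set0]_(j < n) (segment_path u0 (u j) @` `[0, 1]).
have KU : K `<=` U.
  apply: (big_ind (fun A => A `<=` U)) => [//|A B AU BU z [/AU|/BU]//|j _].
  move=> _ [t /= t01 <-]; apply: convex_set_segment => //; exact: (uP j).1.
have cK : compact K.
  apply: (big_ind (@compact _)) => [|A B|j _].
  - exact: compact0.
  - exact: compactU.
  apply: continuous_compact; last exact: segment_compact.
  by apply: continuous_subspaceT; exact: segment_path_continuous.
have sub_hull t : `[0, 1]%classic t -> U (segment_path u0 p t) ->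
    Cn_hull U K (segment_path u0 p t).
  move=> t01 Uq; apply: Cn_hull_block => // j.
  (* At equal parameter [t], the segments to [u j] and to [p] have the same [j]-th block, as their
     endpoints do. *)
  exists (segment_path u0 (u j) t).
    by rewrite /K (bigD1 j) //=; left; exists t.
  apply/rowP => k; have /rowP/(_ k) := (uP j).2.
  by rewrite !mxE => ->.
have hull_closed : closed (Cn_hull U K).
  by apply: compact_closed; [exact: norm_hausdorff | exact: Uhc].
pose B := [set t : R | `[0, 1]%classic t /\ U (segment_path u0 p t)].
have BE : B = `[0, 1]%classic.
  apply: (@segment_connected R 0 1 B).
  - exists 0; split; first by rewrite /= in_itv /= lexx ler01.
    by rewrite /segment_path scale0r add0r.
  - exists (segment_path u0 p @^-1` U) => //.
    apply: open_comp => // t _; exact: segment_path_continuous.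
  (* For [t] in [0, 1], lying in [U] and lying in the hull are equivalent, so [B] is also relatively
     closed. *)
  - exists (segment_path u0 p @^-1` Cn_hull U K).
      apply: preimage_closed => // t _; exact: segment_path_continuous.
    apply/seteqP; split => t [t01]; first by move=> /(sub_hull t t01).
    by case.
have : B 1 by rewrite BE /= in_itv /= ler01 lexx.
by case=> _; rewrite /segment_path scale1r subrK.
Qed.
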